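(* Let $n\geq1$ be an integer, let $\ell$ be an odd prime and let $V$ be a $2n$-dimensional symplectic $\mathbf{F}_\ell$-space. Let $\pi_{\mathrm{vec}}$ be the natural action of $\mathrm{GSp}_{2n}(\mathbf{F}_\ell)=\mathrm{GSp}(V)$ on $V\setminus\{0\}$, and let $\pi_{\mathrm{proj}}$ be the natural action of $\mathrm{PGSp}_{2n}(\mathbf{F}_\ell)=\mathrm{PGSp}(V)$ on the set $\mathbf{P}(V)$ of lines of $V$. If $n\geq 2$, then $$a_{\pi_{\mathrm{vec}}}\bigl(\mathrm{GSp}_{2n}(\mathbf{F}_\ell)\bigr)=\frac{\ell^{2n-2}(\ell^2-1)}{2}\qquad\text{and}\qquad a_{\pi_{\mathrm{proj}}}\bigl(\mathrm{PGSp}_{2n}(\mathbf{F}_\ell)\bigr)=\frac{(\ell+1)(\ell^{2n-2}-1)}{2}.$$ For $n=1$, one has $a_{\pi_{\mathrm{vec}}}(\mathrm{GSp}_{2}(\mathbf{F}_\ell))=\ell(\ell-1)/2$ and $a_{\pi_{\mathrm{proj}}}(\mathrm{PGSp}_{2}(\mathbf{F}_\ell))=(\ell-1)/2$.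
   Context: $V$ carries a nondegenerate alternating form $\langle\ ,\ \rangle$. $\mathrm{GSp}(V)$ is the group of linear automorphisms $g$ of $V$ for which there is $\mu\in\mathbf{F}_\ell^\times$ with $\langle gx,gy\rangle=\mu\langle x,y\rangle$ for all $x,y$; $\mathrm{PGSp}(V)$ is its quotient by the subgroup of scalars. For a permutation $\sigma$ of a finite set $\Omega$, $\mathrm{ind}(\sigma)=|\Omega|-\#\{\text{orbits of }\sigma\text{ on }\Omega\}$. For a faithful transitive permutation representation $\pi$ of a finite group $G$, the Malle invariant is $a_\pi(G)=\min_{1\neq g\in G}\mathrm{ind}(\pi(g))$. *)

(* Defs.v *)
From HB Require Import structures.
From mathcomp Require Import all_boot all_order all_algebra all_fingroup.
From mathcomp Require Import all_solvable all_field.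

Set Implicit Arguments.
Unset Strict Implicit.
Unset Printing Implicit Defensive.

Import GRing.Theory GroupScope.
Local Open Scope ring_scope.

Section MalleInvariant.

Definition ind (T : finType) (s : {perm T}) : nat := (#|T| - #|porbits s|)%N.

(* A permutation representation of G on T is an action with domain exactly G.
   The default value #|T| of the minimum is only relevant when G is trivial,
   since every index is at most #|T|.  Faithfulness and transitivity of [to]
   do not enter the formula. *)
Definition malle_invariant (gT : finGroupType) (G : {group gT}) (T : finType)
    (to : action G T) : nat :=
  \big[minn/#|T|]_(g in G | g != 1%g) ind (actperm to g).

End MalleInvariant.

Section SymplecticSimilitudes.

(* [finvect_type V] is V itself, with its finType structure.  Linear
   automorphisms of V are represented as permutations of the vectors; the
   product of {perm fV} composes from left to right, so that groups act on the
   right, which does not affect indices. *)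
Variables (F : finFieldType) (V : vectType F).
Local Notation fV := (finvect_type V).
Implicit Types (form : {biscalar V}) (g : {perm fV}).

Definition symplectic (form : {biscalar V}) : Prop :=
  (forall x, form x x = 0) /\
  (forall x, (forall y, form x y = 0) -> x = 0).

Definition linear_perm (g : {perm fV}) : bool :=
  [forall a : F, forall x : fV, forall y : fV,
     g (a *: x + y) == a *: g x + g y].

Definition similitude (form : {biscalar V}) (g : {perm fV}) : bool :=
  [exists mu : F, (mu != 0) &&
     [forall x : fV, forall y : fV, form (g x) (g y) == mu * form x y]].

Definition GSp_set (form : {biscalar V}) : {set {perm fV}} :=
  [set g | linear_perm g && similitude form g].

Lemma GSp_group_set form : group_set (GSp_set form).
Proof.
apply/group_setP; split=> [|g h].
  rewrite inE; apply/andP; split.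
    by do 3![apply/forallP=> ?]; rewrite !perm1.
  apply/existsP; exists 1; rewrite oner_neq0 /=.
  by do 2![apply/forallP=> ?]; rewrite !perm1 mul1r.
rewrite !inE => /andP[/forallP gL /existsP[m /andP[m0 /forallP gS]]].
case/andP=> /forallP hL /existsP[p /andP[p0 /forallP hS]].
apply/andP; split.
  apply/forallP=> a; apply/forallP=> x; apply/forallP=> y.
  move/forallP/(_ x)/forallP/(_ y)/eqP: (gL a); rewrite !permM => ->.
  by move/forallP/(_ (g x))/forallP/(_ (g y)): (hL a).
apply/existsP; exists (p * m); rewrite mulf_neq0 //=.
apply/forallP=> x; apply/forallP=> y; rewrite !permM.
move/forallP/(_ (g y))/eqP: (hS (g x)) => ->.
by move/forallP/(_ y)/eqP: (gS x) => ->; rewrite mulrA.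
Qed.

Definition GSp form : {group {perm fV}} := Group (GSp_group_set form).

Definition scalars_set : {set {perm fV}} :=
  [set g : {perm fV} |
     [exists c : F, (c != 0) && [forall x : fV, g x == c *: x]]].

Lemma scalars_group_set : group_set scalars_set.
Proof.
apply/group_setP; split=> [|g h].
  rewrite inE; apply/existsP; exists 1; rewrite oner_neq0 /=.
  by apply/forallP=> ?; rewrite perm1 scale1r.
rewrite !inE => /existsP[c /andP[c0 /forallP gc]].
case/existsP=> d /andP[d0 /forallP hd].
apply/existsP; exists (d * c); rewrite mulf_neq0 //=.
apply/forallP=> x; rewrite permM (eqP (hd _)) (eqP (gc _)).
by rewrite scalerA.
Qed.

Definition scalars : {group {perm fV}} := Group scalars_group_set.

Definition PGSp form : {group coset_of scalars} := (GSp form / scalars)%G.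

Definition is_nonzero (x : fV) : bool := x != 0.

Definition is_line (L : {set fV}) : bool :=
  [exists v : fV, (v != 0) && (L == [set x : fV | x \in <[v : V]>%VS])].

Definition nonzero_vector : finType := {x : fV | is_nonzero x}.
Definition line : finType := {L : {set fV} | is_line L}.

Lemma GSpP form g : reflect
  ((forall (a : F) (x y : fV), g (a *: x + y) = a *: g x + g y) /\
   exists2 mu : F, mu != 0 & forall x y : fV, form (g x) (g y) = mu * form x y)
  (g \in GSp form).
Proof.
rewrite inE; apply: (iffP andP).
  case=> /forallP gL /existsP[m /andP[m0 /forallP gS]]; split.
    by move=> a x y; move/forallP/(_ x)/forallP/(_ y)/eqP: (gL a).
  by exists m => // x y; move/forallP/(_ y)/eqP: (gS x).
case=> gL [m m0 gS]; split.
  by do 3![apply/forallP=> ?]; rewrite gL.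
apply/existsP; exists m; rewrite m0 /=.
by do 2![apply/forallP=> ?]; rewrite gS.
Qed.

Lemma scalarsP (g : {perm fV}) :
  reflect (exists2 c : F, c != 0 & forall x, g x = c *: x) (g \in scalars).
Proof.
rewrite inE; apply: (iffP existsP) => [[c /andP[c0 /forallP gc]]|[c c0 gc]].
  by exists c => // x; apply/eqP.
by exists c; rewrite c0 /=; apply/forallP=> x; rewrite gc.
Qed.

Lemma GSpZ form g (a : F) (x : fV) :
  g \in GSp form -> g (a *: x) = a *: g x.
Proof.
case/GSpP=> gL _.
have g0 : g 0 = 0 by have := gL (-1) 0 0; rewrite scaler0 addr0 scaleN1r addNr.
by rewrite -[a *: x]addr0 gL g0 addr0.
Qed.

Lemma GSp0 form g : g \in GSp form -> g 0 = 0.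
Proof. by move/(GSpZ 0 0); rewrite !scale0r. Qed.

Lemma scalars_normal form : scalars <| GSp form.
Proof.
apply/andP; split; apply/subsetP=> g.
  case/scalarsP=> c c0 gc; apply/GSpP; split.
    by move=> a x y; rewrite !gc scalerDr !scalerA mulrC.
  exists (c * c); first by rewrite mulf_neq0.
  by move=> x y; rewrite !gc linearZl_LR linearZr_LR /= mulrA.
move=> gG; rewrite inE; apply/subsetP=> _ /imsetP[s /scalarsP[c c0 sc] ->].
apply/scalarsP; exists c => // x.
by rewrite /conjg !permM sc (GSpZ _ _ gG) permKV.
Qed.

Lemma GSp_line form g (L : {set fV}) :
  g \in GSp form -> is_line L -> is_line (g @: L).
Proof.
move=> gG /existsP[v /andP[v0 /eqP->]]; apply/existsP; exists (g v).
have g0 := GSp0 gG.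
apply/andP; split; first by rewrite -g0 (inj_eq perm_inj).
apply/eqP/setP=> y; rewrite inE; apply/imsetP/idP => [[x]|].
  rewrite inE => /vlineP[a ->] ->.
  by apply/vlineP; exists a; apply: (GSpZ _ _ gG).
case/vlineP=> a ->; exists (a *: v); last by rewrite (GSpZ _ _ gG).
by rewrite inE; apply/vlineP; exists a.
Qed.

Lemma scalars_line (s : {perm fV}) (L : {set fV}) :
  s \in scalars -> is_line L -> s @: L = L.
Proof.
case/scalarsP=> c c0 sc /existsP[v /andP[v0 /eqP->]].
apply/eqP; rewrite eqEcard card_imset ?leqnn ?andbT; last exact: perm_inj.
apply/subsetP=> _ /imsetP[x xv ->]; rewrite inE in xv.
by rewrite inE sc; apply: (@memvZ F V).
Qed.

Lemma GSp_sub_vec form :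
  GSp form \subset subact_dom is_nonzero 'P.
Proof.
apply/subsetP=> g gG; rewrite inE in_setT /= inE; apply/subsetP=> x.
rewrite !inE /= apermE /is_nonzero.
have g0 := GSp0 gG.
by rewrite -{2}g0 (inj_eq perm_inj).
Qed.

Lemma GSp_sub_line form :
  GSp form \subset subact_dom is_line ('P^*).
Proof.
apply/subsetP=> g gG; rewrite inE in_setT /= inE; apply/subsetP=> L.
by rewrite !inE /=; apply: GSp_line gG.
Qed.

Definition GSp_vec form : action (GSp form) nonzero_vector :=
  ('P^? \ GSp_sub_vec form)%act.

Definition GSp_line_action form : action (GSp form) line :=
  ('P^*^? \ GSp_sub_line form)%act.

Definition PGSp_proj form : action (PGSp form) line :=
  (GSp_line_action form %% scalars)%act.

Lemma GSp_vecE form g (x : nonzero_vector) :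
  g \in GSp form -> val (GSp_vec form x g) = g (val x).
Proof.
move=> gG; rewrite /= /ract val_subact (subsetP (GSp_sub_vec form)) //.
Qed.

Lemma GSp_lineE form g (L : line) :
  g \in GSp form -> val (GSp_line_action form L g) = g @: val L.
Proof.
move=> gG; rewrite /= val_subact (subsetP (GSp_sub_line form)) //.
Qed.

Lemma PGSp_projE form g (L : line) : g \in GSp form ->
  val (PGSp_proj form L (coset scalars g)) = g @: val L.
Proof.
move=> gG; rewrite [PGSp_proj _ _ _]modactE //.
- exact: GSp_lineE.
- exact: (subsetP (normal_norm (scalars_normal form))).
apply/afixP=> s /setIP[sG sZ]; apply: val_inj.
by rewrite GSp_lineE // scalars_line // (valP L).
Qed.

End SymplecticSimilitudes.

(* Main.v *)
From HB Require Import structures.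
Require Import Defs.
From mathcomp Require Import all_boot all_order all_algebra all_fingroup.
From mathcomp Require Import all_solvable all_field zify ring.

(* Write q = ell and D = 2n.  A permutation moving m points has index at least
   m/2, with equality for involutions, and at least 2m/3 if it has no 2-cycle,
   so everything reduces to counting fixed vectors and eigenvectors.  If a
   nontrivial g fixes a space of dimension at most D - 2, it moves at least
   q^D - q^(D-2) vectors.  If all eigenspaces of a nonscalar g have dimension
   at most D - 2, it has at most q^(D-2) + q^2 - 2 eigenvectors, by convexity.
   Otherwise, for n >= 2, some scalar multiple of g fixes a hyperplane
   pointwise and is forced to be a transvection, which has no 2-cycles as q is
   odd; the bound 2m/3 then suffices because (q - 1)(q - 3) >= 0.  Equality is
   attained at minus the identity on a hyperbolic plane for n >= 2, and at
   diag(1, -1) for n = 1. *)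

Set Implicit Arguments.
Unset Strict Implicit.
Unset Printing Implicit Defensive.

Import GRing.Theory GroupScope passmx.
Local Open Scope ring_scope.

(** * Orbit counts, the index of a permutation and its minimum *)

Section PermutationIndex.

Variables (T : finType) (s : {perm T}).
Local Notation Fix := [set x | s x == x].

Lemma sum_card_porbits : (\sum_(O in porbits s) #|O| = #|T|)%N.
Proof.
rewrite -(@sum1_card T) (partition_big_imset (porbit s)) /=.
apply: eq_bigr => _ /imsetP[x _ ->]; rewrite -sum1_card.
by apply: eq_bigl => y; rewrite eq_porbit_mem.
Qed.

Lemma card_porbit_eq1 x : (#|porbit s x| == 1)%N = (s x == x).
Proof.
apply/eqP/eqP=> [c1 | sx]; first by have := iter_porbit s x; rewrite c1.
rewrite (_ : porbit s x = [set x]) ?cards1 //; apply/eqP.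
rewrite eqEsubset sub1set porbit_id andbT; apply/subsetP=> _ /porbitP[i ->].
by rewrite inE permX; elim: i => //= i /eqP->; rewrite sx.
Qed.

Lemma card_fixed_porbits : #|[set O in porbits s | #|O| == 1%N]| = #|Fix|.
Proof.
rewrite -(card_imset Fix (@set1_inj T)); apply: eq_card => O.
rewrite inE; apply/andP/imsetP=> [[/imsetP[x _ ->]] | [x]].
  rewrite card_porbit_eq1 => sx; exists x; first by rewrite inE.
  move: sx; rewrite -card_porbit_eq1 => /cards1P[y def]; rewrite def.
  by have := porbit_id s x; rewrite def => /set1P->.
rewrite inE => sx ->; rewrite cards1; split=> //; apply/imsetP; exists x => //.
move: sx; rewrite -card_porbit_eq1 => /cards1P[y def].
by have := porbit_id s x; rewrite def => /set1P->.
Qed.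

(** An orbit weighs its size, plus [k] if it is a fixed point. Comparing this weight with a
    constant, orbit by orbit, bounds the number of orbits from either side. *)
Lemma sum_fixed_porbits k :
  (\sum_(O in porbits s) (#|O| + k * (#|O| == 1)) = #|T| + k * #|Fix|)%N.
Proof.
rewrite big_split /= sum_card_porbits -big_distrr /=; congr (_ + k * _)%N.
by rewrite -card_fixed_porbits -sum1dep_card big_mkcondr.
Qed.

(** Ensures that the truncated subtraction in [ind] is a true difference. *)
Lemma card_porbits_le : (#|porbits s| <= #|T|)%N.
Proof. exact: leq_imset_card. Qed.

(** A fixed point weighs exactly [k + 1], and any other orbit has more than [k] points. *)
Lemma card_porbits_ub k :
    (forall x, s x != x -> (k < #|porbit s x|)%N) ->
  (k.+1 * #|porbits s| <= #|T| + k * #|Fix|)%N.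
Proof.
move=> kP; rewrite mulnC -sum_nat_const -sum_fixed_porbits.
apply: leq_sum => _ /imsetP[x _ ->]; rewrite card_porbit_eq1.
case: eqP => [/eqP|/eqP/kP]; last by lia.
by rewrite -card_porbit_eq1; lia.
Qed.

Lemma leq_card_ind2 : (#|T| <= 2 * ind s + #|Fix|)%N.
Proof.
have: (2 * #|porbits s| <= #|T| + 1 * #|Fix|)%N.
  apply: card_porbits_ub => x; rewrite -card_porbit_eq1.
  by have := card_porbit_neq0 s x; lia.
by have := card_porbits_le; rewrite /ind; lia.
Qed.

(** Without 2-cycles every nontrivial orbit has at least three points, so the orbit bound applies
    with [k = 2]. *)
Lemma leq_card_ind3 :
  (forall x, s (s x) = x -> s x = x) -> (2 * #|T| <= 3 * ind s + 2 * #|Fix|)%N.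
Proof.
move=> s2; have: (3 * #|porbits s| <= #|T| + 2 * #|Fix|)%N.
  apply: card_porbits_ub => x sx; move: (sx); rewrite -card_porbit_eq1.
  have: #|porbit s x| != 2.
    by apply: contraNneq sx => c2; have := iter_porbit s x; rewrite c2 => /s2->.
  by have := card_porbit_neq0 s x; lia.
by have := card_porbits_le; rewrite /ind; lia.
Qed.

(** Orbits have one or two points, and with [k = 1] both kinds weigh 2, so the bound of
    [leq_card_ind2] is attained. *)
Lemma involution_ind :
  (forall x, s (s x) = x) -> (2 * ind s + #|Fix| <= #|T|)%N.
Proof.
move=> s2; suff: (#|T| + 1 * #|Fix| <= 2 * #|porbits s|)%N.
  by have := card_porbits_le; rewrite /ind; lia.
rewrite [leqRHS]mulnC -sum_nat_const -sum_fixed_porbits.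
apply: leq_sum => _ /imsetP[x _ ->].
have := uniq_traject_porbit s x.
(* An orbit of three or more points would make [x] and [s (s x) = x] distinct. *)
case: #|_| => [|[|[|k]]] //=; rewrite s2.
by rewrite !inE eqxx !orbT.
Qed.

End PermutationIndex.

(** Doubling avoids halves: the two bounds squeeze twice the minimum to exactly [b]. *)
Lemma malle_invariant_half (gT : finGroupType) (G : {group gT}) (T : finType)
    (to : action G T) b :
    (forall g, g \in G -> g != 1%g -> (b <= 2 * ind (actperm to g))%N) ->
    (exists g, [/\ g \in G, g != 1%g & (2 * ind (actperm to g) <= b)%N]) ->
  malle_invariant to = (b %/ 2)%N.
Proof.
move=> lb [g [gG g1 ub]]; set m := malle_invariant to.
have m_g: (m <= ind (actperm to g))%N.
  by apply: (@Order.TotalTheory.bigmin_le_cond _ nat); rewrite gG.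
suff: (b <= 2 * m)%N by lia.
rewrite /m /malle_invariant; elim/big_rec: _ => [|h x /andP[hG h1] bx].
  (* The default value [#|T|] of the minimum is at least the index of [g], so the bound at [g]
     covers it. *)
  by have := lb g gG g1; rewrite /ind; lia.
by have := lb h hG h1; rewrite minnE; lia.
Qed.

(** Turns a linear function into a homomorphism, to which the dimension formula for kernel and image
    applies. *)
Lemma linear_hom (F : fieldType) (U W : vectType F) (f : U -> W) :
  linear f -> {h : 'Hom(U, W) | h =1 f}.
Proof.
move=> lf; pose fL : {linear U -> W} :=
  HB.pack f (GRing.isLinear.Build F U W *:%R f lf).
by exists (linfun fL) => x; rewrite lfunE.
Qed.

(** * Counting vectors and lines over a finite field *)

Section Lines.

Variables (F : finFieldType) (V : vectType F).
Local Notation fV := (finvect_type V).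
Local Notation q := #|F|.
Local Notation D := (\dim {:V}).

Lemma card_vspace_set (U : {vspace V}) :
  #|[set x : fV | x \in U]| = (q ^ \dim U)%N.
Proof.
rewrite cardsE; case: V U => T cT U.
exact: (@card_vspace F (finvect_type (Vector.Pack cT)) cT U).
Qed.

Lemma card_vspace_nz (U : {vspace V}) :
  #|[set x : fV | (x != 0) && (x \in U)]| = (q ^ \dim U - 1)%N.
Proof.
have U0: (0 : fV) \in [set x : fV | x \in U] by rewrite inE; apply: (mem0v U).
rewrite -card_vspace_set (cardsD1 (0 : fV) [set x : fV | x \in U]) U0.
rewrite add1n subn1 /=.
by apply: eq_card => x; rewrite !inE.
Qed.

Lemma card_nonzero (P : pred fV) :
  #|[set x : nonzero_vector V | P (val x)]| = #|[set x : fV | (x != 0) && P x]|.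
Proof.
rewrite -(card_imset _ (val_inj)); apply: eq_card => x; rewrite !inE.
apply/imsetP/andP=> [[y] | [x0 Px]].
  by rewrite inE => Py ->; split=> //; exact: (valP y).
by exists (Sub x x0); rewrite ?inE.
Qed.

Lemma card_nonzero_vector : (#|nonzero_vector V| + 1 = q ^ D)%N.
Proof.
have q0: (0 < q)%N by apply/card_gt0P; exists 0.
rewrite -[RHS](@subnK 1) ?expn_gt0 ?q0 // -(card_vspace_nz fullv).
rewrite -(card_nonzero (mem fullv)); congr (_ + 1)%N.
by apply: eq_card => x; rewrite !inE memvf.
Qed.

Lemma span_line_subproof (x : nonzero_vector V) :
  is_line [set y : fV | y \in <[val x : V]>%VS].
Proof.
by apply/existsP; exists (val x); rewrite eqxx andbT; exact: (valP x).
Qed.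

Definition span_line x : line V := Sub _ (span_line_subproof x).

Lemma span_line_eq x y :
  (span_line x == span_line y) = (val x \in <[val y : V]>%VS).
Proof.
rewrite -val_eqE /=; apply/eqP/idP=> [/setP/(_ (val x))|].
  by rewrite !inE memv_line => <-.
case/vlineP=> c def_x.
have c0: c != 0.
  apply: contraNneq (valP x : val x != 0) => c0.
  by apply/eqP; apply: etrans def_x _; rewrite c0 scale0r.
apply/setP=> z; rewrite !inE def_x.
apply/vlineP/vlineP=> [] [d ->]; first by exists (d * c); rewrite scalerA.
by exists (d / c); rewrite scalerA divfK.
Qed.

Lemma span_line_surj (l : line V) : exists x, l = span_line x.
Proof.
have /existsP[v /andP[v0 /eqP def_l]] := valP l.
by exists (Sub v v0); apply: val_inj.
Qed.

(** The fibre of [span_line] over a line consists of its [q - 1] nonzero vectors. Counts of lines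
    thus become counts of vectors without division. *)
Lemma card_span_line (A : {pred line V}) :
  #|[set x | span_line x \in A]| = ((q - 1) * #|A|)%N.
Proof.
rewrite -sum1dep_card (partition_big span_line (mem A)) //=.
rewrite mulnC -sum_nat_const.
apply: eq_bigr => l lA; have /existsP[v /andP[v0 /eqP def_l]] := valP l.
pose y : nonzero_vector V := Sub v v0.
have ->: l = span_line y by exact: val_inj.
have := card_vspace_nz <[v : V]>; rewrite dim_vline v0 expn1 => <-.
rewrite -(card_nonzero (fun x : fV => x \in <[v : V]>%VS)) -sum1dep_card.
apply: eq_bigl => x; rewrite -(span_line_eq x y).
case: eqP => [->|]; rewrite ?andbF // andbT.
by rewrite (_ : span_line y = l) //; exact: val_inj.
Qed.

Lemma card_line : ((q - 1) * #|line V| + 1 = q ^ D)%N.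
Proof.
rewrite -(card_span_line predT) -card_nonzero_vector; congr (_ + 1)%N.
by apply: eq_card => x; rewrite !inE.
Qed.

End Lines.

(** * Bounds on the number of eigenvectors *)

Section Eigenvectors.

Variables (F : finFieldType) (V : vectType F) (h : 'End(V)).
Local Notation fV := (finvect_type V).
Local Notation q := #|F|.
Local Notation D := (\dim {:V}).

(** For injective [h] these are the nonzero vectors on the lines fixed by [h], so their number is
    [q - 1] times that of the fixed points on lines. *)
Definition eigenvectors := [set x : fV | (x != 0) && (h x \in <[x : V]>%VS)].

Lemma memv_leigenspace c x : (x \in leigenspace h c) = (h x == c *: x).
Proof. by rewrite memv_ker !lfun_simp subr_eq0. Qed.

Lemma eigenvectorsP (x : fV) :
  reflect (x != 0 /\ exists c, h x = c *: x) (x \in eigenvectors).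
Proof. by rewrite inE; apply: (iffP andP) => [] [x0 /vlineP]. Qed.

(* [h - c] maps the eigenvectors outside [leigenspace h c] injectively into its
   nonzero image, whose dimension is the codimension of [leigenspace h c]. *)
Lemma card_eigenvectors_le c :
  (#|eigenvectors| + 2 <=
     q ^ \dim (leigenspace h c) + q ^ (D - \dim (leigenspace h c)))%N.
Proof.
set a := \dim (leigenspace h c).
set E := leigenspace h c; set k := h - c *: \1%VF.
have dim_img: \dim (limg k) = (D - a)%N.
  by have := limg_ker_dim k fullv; rewrite capfv -/E -/a; lia.
have q0: (0 < q)%N by apply/card_gt0P; exists 0.
rewrite -(cardsID [set x : fV | x \in E]).
have le1: (#|eigenvectors :&: [set x : fV | x \in E]| <= q ^ a - 1)%N.
  rewrite -card_vspace_nz; apply/subset_leq_card/subsetP=> x.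
  by rewrite !inE => /andP[/andP[-> _] ->].
have le2: (#|eigenvectors :\: [set x : fV | x \in E]| <= q ^ (D - a) - 1)%N.
  rewrite -dim_img -card_vspace_nz.
  rewrite -(@card_in_imset _ _ (k : fV -> fV)) => [|x y].
    apply/subset_leq_card/subsetP=> _ /imsetP[x /setDP[_ xE] ->].
    rewrite inE; apply/andP; split; last by apply/memv_img/memvf.
    by apply: contra xE => kx; rewrite inE; apply: etrans (memv_ker k x) kx.
  case/setDP=> /eigenvectorsP[x0 [d dx]] xE.
  case/setDP=> /eigenvectorsP[y0 [b by_]] yE.
  move=> kxy; have: h (k x) = h (k y) by rewrite kxy.
  have kx: k x = (d - c) *: x by rewrite !lfun_simp dx scalerBl.
  have ky: k y = (b - c) *: y by rewrite !lfun_simp by_ scalerBl.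
  have kx0: k x != 0.
    by apply: contra xE => kx0; rewrite inE; apply: etrans (memv_ker k x) kx0.
  rewrite [in h (k x)]kx [in h (k y)]ky !linearZ /= dx by_.
  rewrite !scalerA [_ * d]mulrC [_ * b]mulrC -!scalerA -kx -ky -kxy.
  move/eqP; rewrite -subr_eq0 -scalerBl scaler_eq0 (negPf kx0) orbF subr_eq0.
  move/eqP=> db; move: kxy; rewrite kx ky db; apply: scalerI.
  by apply: contraNneq kx0 => bc; rewrite kx db bc scale0r.
have: (0 < q ^ a)%N by rewrite expn_gt0 q0.
have: (0 < q ^ (D - a))%N by rewrite expn_gt0 q0.
move: le1 le2; move: #|_| #|_| (q ^ a)%N (q ^ (D - a))%N; lia.
Qed.

(** Injectivity leaves [q - 1] possible eigenvalues, each contributing at most [q - 1] nonzero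
    vectors. *)
Lemma card_eigenvectors_lines :
    lker h == 0%VS -> (forall c, (\dim (leigenspace h c) <= 1)%N) ->
  (#|eigenvectors| <= (q - 1) * (q - 1))%N.
Proof.
move=> h0 dimE.
pose B (c : F) := [set x : fV | (x != 0) && (x \in leigenspace h c)].
have cB c: (#|B c| <= q - 1)%N.
  rewrite card_vspace_nz leq_sub2r //.
  have q0: (0 < q)%N by apply/card_gt0P; exists 0.
  by rewrite -[leqRHS]expn1 leq_pexp2l.
have sub: eigenvectors \subset \bigcup_(c in [set~ 0]) B c.
  apply/subsetP=> x /eigenvectorsP[x0 [c hx]]; apply/bigcupP; exists c.
    rewrite !inE; apply: contraNneq x0 => c0.
    have: (x : V) \in lker h by rewrite memv_ker hx c0 scale0r.
    by rewrite (eqP h0) memv0.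
  by rewrite inE x0 memv_leigenspace hx /=.
apply: leq_trans (subset_leq_card sub) _.
have -> : ((q - 1) * (q - 1) = \sum_(c in [set~ (0 : F)%R]) (q - 1))%N.
  by rewrite sum_nat_const cardsC1 subn1.
apply: (big_ind2 (fun (A : {set fV}) m => #|A| <= m)%N) => [|A m C p mA pC|c _].
- by rewrite cards0.
- by apply: leq_trans (leq_card_setU _ _) _; exact: leq_add.
- exact: cB.
Qed.

(** If some eigenspace has dimension [a] with [2 <= a <= D - 2], then [q ^ a + q ^ (D - a)] is
    largest at the ends of this range, by convexity. Otherwise all eigenspaces have dimension at
    most 1. *)
Lemma card_eigenvectors_codim2 :
    (4 <= D)%N -> lker h == 0%VS ->
    (forall c, (\dim (leigenspace h c) <= D - 2)%N) ->
  (#|eigenvectors| + 2 <= q ^ (D - 2) + q ^ 2)%N.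
Proof.
move=> D4 h0 dimE; have q0: (0 < q)%N by apply/card_gt0P; exists 0.
have [/existsP[c c2]|] := boolP [exists c, 1 < \dim (leigenspace h c)]%N.
  apply: leq_trans (card_eigenvectors_le c) _; set a := \dim _ in c2 *.
  have aD: (a <= D - 2)%N := dimE c.
  have -> : (q ^ a = q ^ (a - 2) * q ^ 2)%N by rewrite -expnD subnK.
  have -> : (q ^ (D - 2) = q ^ (a - 2) * q ^ (D - a))%N.
    by rewrite -expnD; congr (_ ^ _)%N; lia.
  have: (q ^ 2 <= q ^ (D - a))%N by rewrite leq_pexp2l //; lia.
  have: (0 < q ^ (a - 2))%N by rewrite expn_gt0 q0.
  (* With [z + 1 = q ^ (a - 2)], [x = q ^ 2] and [y = q ^ (D - a)] the claim reads
     [z * x <= z * y]. *)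
  move: (q ^ (a - 2))%N (q ^ 2)%N (q ^ (D - a))%N => [//|z] x y _.
  move=> /(leq_mul (leqnn z)); lia.
rewrite negb_exists => /forallP dim1.
have /(card_eigenvectors_lines h0): forall c, (\dim (leigenspace h c) <= 1)%N.
  by move=> c; rewrite leqNgt dim1.
(* It suffices that [(q - 1) ^ 2 + 2 <= q ^ 2 + 1]. *)
have : (1 <= q ^ (D - 2))%N by rewrite expn_gt0 q0.
move: (q ^ (D - 2))%N #|_| => Q N; rewrite -mulnn; nia.
Qed.

End Eigenvectors.

(** * Symplectic forms and similitudes fixing a hyperplane *)

Section SymplecticForm.

Variables (F : finFieldType) (V : vectType F) (form : {biscalar V}).
Hypothesis sform : symplectic form.
Local Notation D := (\dim {:V}).

Lemma symplecticC x y : form y x = - form x y.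
Proof.
have [form0 _] := sform.
have := form0 (x + y); rewrite linearDl !linearDr /= !form0 add0r addr0.
by move/eqP; rewrite addrC addr_eq0 => /eqP.
Qed.

Lemma hyperbolic_pair : (0 < D)%N -> exists e f, form e f = 1.
Proof.
move=> D0; have [_ nondeg] := sform.
have e0: vpick {:V} != 0 by rewrite vpick0 -dimv_eq0 -lt0n.
move: (vpick _) e0 => e e0.
have [/forallP z|] := boolP [forall y : finvect_type V, form e y == 0].
  by case/eqP: e0; apply: nondeg => y; exact/eqP/z.
rewrite negb_forall => /existsP[y y0].
by exists e, ((form e y)^-1 *: (y : V)); rewrite linearZr_LR /= mulVf.
Qed.

(* A similitude with factor [mu] fixing a hyperplane [W] pointwise: if
   [u = h x - x] were outside [W], then [V = W + <u>], and
   [form u w = (mu - 1) * form x w] on [W].  When [mu = 1] this makes [u]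
   orthogonal to [V]; otherwise [W] is isotropic, and its vectors orthogonal to
   [u] (which exist as [dim W >= 3]) are orthogonal to [V]. *)
Lemma hyperplane_similitude (h : 'End(V)) mu :
    (forall x y, form (h x) (h y) = mu * form x y) ->
    (4 <= D)%N -> (D - 1 <= \dim (leigenspace h 1))%N ->
  forall x, h (h x - x) = h x - x.
Proof.
have [form0 nondeg] := sform.
move=> hmu D4; set W := leigenspace h 1 => dimW x; set u := h x - x.
have memW w : (w \in W) = (h w == w) by rewrite memv_leigenspace scale1r.
apply/eqP; rewrite -memW; apply/negPn/negP=> uW.
have u0: u != 0 by apply: contraNneq uW => ->; apply: mem0v.
have WuV: (W + <[u]>)%VS = fullv.
  apply/eqP; rewrite eqEdim subvf /=.
  have := dimv_sum_cap W <[u]>; rewrite dim_vline u0.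
  suff ->: (W :&: <[u]>)%VS = 0%VS by rewrite dimv0; lia.
  apply/eqP; rewrite -subv0; apply/subvP=> y; rewrite memv_cap memv0.
  case/andP=> yW /vlineP[c def_y]; rewrite def_y scaler_eq0 (negPf u0) orbF.
  apply: contraNT uW => c0; rewrite def_y in yW.
  by rewrite -[u]scale1r -(mulVf c0) -scalerA; apply: memvZ.
have orthV z : (forall w, w \in W -> form z w = 0) -> form z u = 0 -> z = 0.
  move=> zW zu; apply: nondeg => y; have := memvf y; rewrite -WuV.
  case/memv_addP=> w wW [_ /vlineP[c ->] ->].
  by rewrite linearDr linearZr_LR /= zW // zu mulr0 addr0.
have [mu1|mu1] := eqVneq mu 1.
  case/eqP: u0; apply: orthV (form0 u) => w; rewrite memW => /eqP hw.
  by rewrite linearBl /= -{1}hw hmu mu1 mul1r subrr.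
have Wiso w w' : w \in W -> w' \in W -> form w w' = 0.
  rewrite !memW => /eqP hw /eqP hw'.
  have := hmu w w'; rewrite hw hw' => /eqP.
  rewrite -[X in X == _]mul1r -subr_eq0 -mulrBl mulf_eq0 subr_eq0 eq_sym.
  by rewrite (negPf mu1) => /eqP.
have [|phi phiE] := @linear_hom F V F^o (form ^~ u).
  by move=> a y z; rewrite linearDl linearZl_LR.
have := limg_ker_dim phi W; have := dimvS (subvf (phi @: W)%VS).
rewrite dimvf /dim /= => le1 dims.
have: (W :&: lker phi)%VS != 0%VS by rewrite -dimv_eq0; lia.
rewrite -vpick0; set w := vpick _ => w0.
have: w \in (W :&: lker phi)%VS by apply: memv_pick.
rewrite memv_cap memv_ker phiE => /andP[wW /eqP wu].
by case/eqP: w0; apply: orthV wu => w'; exact: Wiso.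
Qed.

End SymplecticForm.

(** Since [u = h x - x] is fixed, [h (h x) = x + 2 u], hence [(c - 1) x = 2 u]. Either [c = 1] and
    [u = 0], or [x] is a multiple of [u] and so is fixed. This excludes 2-cycles of a transvection
    on vectors ([c = 1]) and on lines (any [c]). *)
Lemma unipotent_square_eigen (F : fieldType) (V : vectType F) (h : 'End(V))
    x c :
    (2 : F) != 0 -> h (h x - x) = h x - x -> h (h x) = c *: x -> h x = x.
Proof.
move=> two0 hu hhx; set u := h x - x in hu.
have hx: h x = x + u by rewrite /u addrC subrK.
have cu: (c - 1) *: x = 2 *: u.
  rewrite scalerBl -hhx hx linearD /= hu hx scale1r scaler_nat mulr2n.
  by rewrite [x + u]addrC addrAC addrK.
have [c1|c1] := eqVneq (c - 1) 0.
  move/eqP: cu; rewrite c1 scale0r eq_sym scaler_eq0 (negPf two0) /= => /eqP u0.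
  by rewrite hx u0 addr0.
have ->: x = ((c - 1)^-1 * 2) *: u.
  by rewrite -scalerA -cu scalerA mulVf ?scale1r.
by rewrite linearZ /= hu.
Qed.

(** * Index bounds for a similitude, seen as a permutation [g] and an endomorphism [h] *)

Section Indices.

Variables (F : finFieldType) (V : vectType F) (form : {biscalar V}).
Local Notation fV := (finvect_type V).
Local Notation q := #|F|.
Local Notation D := (\dim {:V}).

Variables (g : {perm fV}) (h : 'End(V)).
Hypotheses (gG : g \in GSp form) (hE : forall x : V, h x = g x).

Local Notation vec_perm := (actperm (GSp_vec form) g).
Local Notation line_perm := (actperm (PGSp_proj form) (coset (scalars V) g)).

Lemma val_vec_perm x : val (vec_perm x) = g (val x).
Proof. by rewrite actpermE; apply: GSp_vecE. Qed.

(** Makes [span_line] equivariant, so that the projective action can be computed on vectors. *)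
Lemma line_permE x : line_perm (span_line x) = span_line (vec_perm x).
Proof.
apply: val_inj; rewrite actpermE PGSp_projE //=.
apply/setP=> y; rewrite inE; apply/imsetP/idP=> [[z]|].
  rewrite inE => /vlineP[c ->] ->; apply/vlineP; exists c.
  by rewrite val_vec_perm; apply: (GSpZ _ _ gG).
case/vlineP=> c def_y; exists (c *: (val x : fV)).
  by rewrite inE; apply/vlineP; exists c.
by rewrite (GSpZ _ _ gG) -val_vec_perm.
Qed.

Lemma card_fix_vec :
  (#|[set x | vec_perm x == x]| + 1 = q ^ \dim (leigenspace h 1))%N.
Proof.
have q0: (0 < q)%N by apply/card_gt0P; exists 0.
rewrite -[RHS](@subnK 1) ?expn_gt0 ?q0 // -card_vspace_nz.
rewrite -(card_nonzero (fun x => x \in leigenspace h 1)); congr (_ + 1)%N.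
apply: eq_card => x; rewrite !inE -val_eqE val_vec_perm.
by have := memv_leigenspace h 1 (val x); rewrite scale1r hE => ->.
Qed.

Lemma fixed_line x :
  (line_perm (span_line x) == span_line x) = (h (val x) \in <[val x : V]>%VS).
Proof. by rewrite line_permE span_line_eq val_vec_perm hE. Qed.

Lemma card_fix_line :
  ((q - 1) * #|[set l | line_perm l == l]| = #|eigenvectors h|)%N.
Proof.
rewrite -card_span_line /eigenvectors -card_nonzero.
by apply: eq_card => x; rewrite !inE fixed_line.
Qed.

Lemma lker_similitude : lker h == 0%VS.
Proof.
by apply/lker0P=> x y; rewrite !hE => /(@perm_inj fV g).
Qed.

Lemma leq_vec_ind2 : (q ^ D <= 2 * ind vec_perm + q ^ \dim (leigenspace h 1))%N.
Proof.
by rewrite -card_fix_vec -card_nonzero_vector addnA leq_add2r leq_card_ind2.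
Qed.

Lemma leq_line_ind2 :
  (q ^ D <= 2 * ((q - 1) * ind line_perm) + #|eigenvectors h| + 1)%N.
Proof.
rewrite -card_fix_line -card_line leq_add2r mulnCA -mulnDr.
by rewrite leq_mul2l leq_card_ind2 orbT.
Qed.

Lemma vec_ind_involution (A : {vspace V}) :
    (forall x, g (g x) = x) -> (forall x, x \in A -> h x = x) ->
  (2 * ind vec_perm + q ^ \dim A <= q ^ D)%N.
Proof.
move=> g2 hA.
apply: (@leq_trans (2 * ind vec_perm + q ^ \dim (leigenspace h 1))).
  rewrite leq_add2l leq_pexp2l //; first by apply/card_gt0P; exists 0.
  apply/dimvS/subvP=> x xA; rewrite memv_leigenspace scale1r; exact/eqP/hA.
rewrite -card_fix_vec -card_nonzero_vector addnA leq_add2r.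
by apply: involution_ind => x; apply: val_inj; rewrite !val_vec_perm.
Qed.

(** The nonzero vectors of [A] and of [B] are eigenvectors, and the two sets are disjoint because
    [1] and [-1] differ. *)
Lemma line_ind_involution (A B : {vspace V}) : (2 : F) != 0 ->
    (forall x, g (g x) = x) ->
    (forall x, x \in A -> h x = x) -> (forall x, x \in B -> h x = - x) ->
  (2 * ((q - 1) * ind line_perm) + q ^ \dim A + q ^ \dim B <= q ^ D + 1)%N.
Proof.
move=> two0 g2 hA hB; have q0: (0 < q)%N by apply/card_gt0P; exists 0.
have: (q ^ \dim A + q ^ \dim B <= #|eigenvectors h| + 2)%N.
  have: (#|[set x : fV | (x != 0)%R && (x \in A)]| +
         #|[set x : fV | (x != 0)%R && (x \in B)]| <= #|eigenvectors h|)%N.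
    rewrite -cardsUI [X in (_ + X)%N](_ : _ = 0)%N ?addn0.
      apply/subset_leq_card/subsetP=> x; rewrite !inE -andb_orr.
      case/andP=> x0 /orP[xA|xB]; rewrite x0 /=.
        by rewrite hA // memv_line.
      by rewrite hB // memvN memv_line.
    apply: eq_card0 => x; rewrite !inE.
    apply/negP=> /andP[/andP[x0 xA] /andP[_ xB]].
    case/negP: x0; have := hA x xA; rewrite hB // => /eqP.
    rewrite eq_sym -addr_eq0 -mulr2n -scaler_nat scaler_eq0 => /orP[] //.
    by rewrite (negPf two0).
  rewrite !card_vspace_nz.
  have: (0 < q ^ \dim A)%N by rewrite expn_gt0 q0.
  have: (0 < q ^ \dim B)%N by rewrite expn_gt0 q0.
  by move: #|_| (q ^ \dim A)%N (q ^ \dim B)%N; lia.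
have: ((q - 1) * (2 * ind line_perm + #|[set l | line_perm l == l]|)
    <= (q - 1) * #|line V|)%N.
  rewrite leq_mul2l involution_ind ?orbT // => l.
  have [x ->] := span_line_surj l; rewrite !line_permE; congr span_line.
  by apply: val_inj; rewrite !val_vec_perm.
rewrite mulnDr card_fix_line -card_line mulnCA; lia.
Qed.

Hypothesis sform : symplectic form.

Lemma GSp_mu : exists mu, forall x y : V, form (h x) (h y) = mu * form x y.
Proof.
by have /GSpP[_ [mu _ gmu]] := gG; exists mu => x y; rewrite !hE gmu.
Qed.

Lemma dim_fix_lt : g != 1%g -> (\dim (leigenspace h 1) < D)%N.
Proof.
apply: contraR; rewrite -leqNgt => dimE; apply/eqP/permP=> x.
have: leigenspace h 1 == fullv by rewrite eqEdim subvf.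
move/eqP=> Ef; have := memvf (x : V).
by rewrite -Ef memv_leigenspace scale1r hE perm1 => /eqP.
Qed.

Lemma dim_leigenspace_lt c :
  g \notin scalars V -> (\dim (leigenspace h c) < D)%N.
Proof.
apply: contraR; rewrite -leqNgt => dimE.
have: leigenspace h c == fullv by rewrite eqEdim subvf.
move/eqP=> Ef; have hc x : h x = c *: x.
  by apply/eqP; rewrite -memv_leigenspace Ef memvf.
(* The value [c = 0] forces [V] to be zero by injectivity, and then [g] is the scalar 1. *)
have [c0|c0] := eqVneq c 0; last first.
  by apply/scalarsP; exists c => // x; rewrite -hE hc.
apply/scalarsP; exists 1 => [|x]; first exact: oner_neq0.
have x0 (y : V) : y = 0.
  by apply/(lker0P lker_similitude); rewrite !hc c0 !scale0r.
by rewrite (x0 (g x)) (x0 x) scaler0.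
Qed.

(** This general bound is already sharp for [D = 2]. *)
Lemma vec_ind_lb1 : g != 1%g -> (q ^ D <= 2 * ind vec_perm + q ^ (D - 1))%N.
Proof.
move/dim_fix_lt=> ltD; apply: leq_trans leq_vec_ind2 _.
rewrite leq_add2l leq_pexp2l //; first by apply/card_gt0P; exists 0.
by lia.
Qed.

(** A fixed space of codimension at least 2 is covered by [leq_vec_ind2]. A fixed hyperplane makes
    [h] unipotent without 2-cycles, and [leq_card_ind3] applies. *)
Lemma vec_ind_lb : (4 <= D)%N -> (2 < q)%N -> (2 : F) != 0 -> g != 1%g ->
  (q ^ D <= 2 * ind vec_perm + q ^ (D - 2))%N.
Proof.
move=> D4 q3 two0 g1; have ltD := dim_fix_lt g1.
have [le2|] := leqP (\dim (leigenspace h 1)) (D - 2).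
  apply: leq_trans leq_vec_ind2 _; rewrite leq_add2l leq_pexp2l //.
  by apply: leq_trans q3.
move=> gt2; have dimE: \dim (leigenspace h 1) = (D - 1)%N by lia.
have [mu hmu] := GSp_mu.
have unip := hyperplane_similitude sform hmu D4 (eq_leq (esym dimE)).
have: (2 * #|nonzero_vector V|
    <= 3 * ind vec_perm + 2 * #|[set x | vec_perm x == x]|)%N.
  apply: leq_card_ind3 => x.
  move/(congr1 val); rewrite !val_vec_perm -!hE => hhx.
  apply: val_inj; rewrite val_vec_perm -hE.
  by apply: (unipotent_square_eigen (c := 1) two0 (unip _)); rewrite scale1r.
have := card_fix_vec; rewrite dimE; have := card_nonzero_vector V.
have -> : (q ^ D = q ^ (D - 2) * (q * q))%N.
  by rewrite mulnn -expnD subnK //; lia.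
have -> : (q ^ (D - 1) = q ^ (D - 2) * q)%N by rewrite -expnSr; congr expn; lia.
move: #|nonzero_vector V| #|[set x | _]| (ind _) (q ^ (D - 2))%N q q3.
(* Eliminating [N], [f] and [i] leaves [Q * (r - 1) * (r - 3) >= 0]. *)
move=> N f i Q r r3; nia.
Qed.

(** Dividing by [c] moves the eigenvalue [c] to 1, the case that [hyperplane_similitude] treats. *)
Lemma scaled_similitude c : c != 0 -> exists mu, forall x y : V,
  form ((c^-1 *: h)%VF x) ((c^-1 *: h)%VF y) = mu * form x y.
Proof.
move=> c0; have [mu hmu] := GSp_mu; exists (c^-1 * (c^-1 * mu)) => x y.
by rewrite !lfun_simp linearZl_LR linearZr_LR /= hmu !mulrA.
Qed.

(** An eigenvector of a nonscalar map of a plane spans its eigenspace, so there are at most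
    [2 * q - 2] eigenvectors. *)
Lemma line_ind_lb1 : D = 2%N -> g \notin scalars V ->
  (q ^ 2 + 1 <= 2 * ((q - 1) * ind line_perm) + 2 * q)%N.
Proof.
move=> D2 gS; have q0: (0 < q)%N by apply/card_gt0P; exists 0.
have := leq_line_ind2; rewrite D2 => lb.
suff: (#|eigenvectors h| + 2 <= 2 * q)%N by lia.
have [->|[x /eigenvectorsP[x0 [c hx]]]] := set_0Vmem (eigenvectors h).
  by rewrite cards0; lia.
have := card_eigenvectors_le h c; rewrite D2.
suff ->: \dim (leigenspace h c) = 1%N by rewrite expn1; lia.
have := dim_leigenspace_lt c gS; rewrite D2.
suff: \dim (leigenspace h c) != 0%N by lia.
rewrite dimv_eq0; apply: contraNneq x0 => Ec.
have: (x : V) \in leigenspace h c by rewrite memv_leigenspace hx.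
by rewrite Ec memv0.
Qed.

Lemma line_ind_lb : (4 <= D)%N -> (2 < q)%N -> (2 : F) != 0 ->
    g \notin scalars V ->
  (q ^ D + 1 <= 2 * ((q - 1) * ind line_perm) + q ^ (D - 2) + q ^ 2)%N.
Proof.
move=> D4 q3 two0 gS.
have [/forallP le2|] := boolP [forall c, \dim (leigenspace h c) <= D - 2]%N.
  have := card_eigenvectors_codim2 D4 lker_similitude le2.
  by have := leq_line_ind2; lia.
rewrite negb_forall => /existsP[c]; rewrite -ltnNge => gt2.
have dimE: \dim (leigenspace h c) = (D - 1)%N.
  by have := dim_leigenspace_lt c gS; lia.
have c0: c != 0.
  apply: contraTneq gt2 => ->; rewrite /leigenspace scale0r subr0.
  by rewrite (eqP lker_similitude) dimv0.
have [mu hmu] := scaled_similitude c0.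
have sameE: leigenspace (c^-1 *: h)%VF 1 = leigenspace h c.
  apply/vspaceP=> x; rewrite !memv_leigenspace scale1r !lfun_simp.
  by rewrite -(inj_eq (scalerI c0)) scalerA mulfV // scale1r.
have unip := hyperplane_similitude sform hmu D4.
rewrite sameE in unip; have {}unip := unip (eq_leq (esym dimE)).
have: (2 * #|line V|
    <= 3 * ind line_perm + 2 * #|[set l | line_perm l == l]|)%N.
  apply: leq_card_ind3 => l; have [x ->] := span_line_surj l.
  rewrite !line_permE => /eqP; rewrite span_line_eq !val_vec_perm -!hE.
  case/vlineP=> b hhx; apply/eqP; rewrite span_line_eq val_vec_perm -hE.
  apply/vlineP; exists c.
  (* From [h (h x) = b x], the map [c^-1 h] has square eigenvalue [c^-2 b] at [x]; hence it fixes
     [x], and [h x = c x]. *)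
  have := unipotent_square_eigen (c := c^-1 * (c^-1 * b)) two0 (unip (val x)).
  rewrite !lfun_simp linearZ /= hhx !scalerA !mulrA => /(_ erefl).
  by move/(congr1 ( *:%R c)); rewrite scalerA mulfV // scale1r.
move/(leq_mul (leqnn (q - 1)%N)).
rewrite mulnDr !(mulnCA (q - 1)%N) card_fix_line.
have := card_eigenvectors_le h c; rewrite dimE; have := card_line V.
have -> : (D - (D - 1) = 1)%N by lia.
have -> : (q ^ D = q ^ (D - 2) * (q * q))%N.
  by rewrite mulnn -expnD subnK //; lia.
have -> : (q ^ (D - 1) = q ^ (D - 2) * q)%N by rewrite -expnSr; congr expn; lia.
have : (0 < q ^ (D - 2))%N by rewrite expn_gt0; lia.
rewrite expn1 -mulnn.
move: ((q - 1) * #|line V|)%N ((q - 1) * ind _)%N #|eigenvectors h|.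
(* After removing a factor [r - 1] the claim is [4 (Q r - 1) >= 3 (Q - 1) (r + 1)], that is
   [Q (r - 3) + 3 r - 1 >= 0]. *)
move: (q ^ (D - 2))%N q q3 => Q r r3 Q0 N i f; nia.
Qed.

End Indices.

(** * Involutions attaining the bounds *)

Section Witnesses.

Variables (F : finFieldType) (V : vectType F) (form : {biscalar V}).
Hypothesis sform : symplectic form.
Local Notation fV := (finvect_type V).
Local Notation q := #|F|.
Local Notation D := (\dim {:V}).

Lemma GSp_hom (g : {perm fV}) :
  g \in GSp form -> exists h : 'End(V), forall x : V, h x = g x.
Proof.
case/GSpP=> gL _; have [|h hE] := @linear_hom F V V g; last by exists h.
by move=> a x y; apply: gL.
Qed.

Lemma GSp_involution (h : 'End(V)) mu : mu != 0 ->
    (forall x, h (h x) = x) ->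
    (forall x y, form (h x) (h y) = mu * form x y) ->
  exists g : {perm fV},
    [/\ g \in GSp form, forall x : V, h x = g x & forall x, g (g x) = x].
Proof.
move=> mu0 hh hmu; have h_inj: injective (h : fV -> fV) by apply: can_inj hh.
exists (perm h_inj); split=> [|x|x].
- apply/GSpP; split=> [a x y|]; first by rewrite !permE linearP.
  by exists mu => // x y; rewrite !permE hmu.
- by rewrite permE.
- by rewrite !permE; apply: hh.
Qed.

Lemma hyperbolic_dim e f : form e f = 1 -> \dim (<[e]> + <[f]>) = 2%N.
Proof.
move=> ef; have [form0 _] := sform.
have e0: e != 0.
  by apply: contra_eq_neq ef => ->; rewrite linear0l eq_sym oner_neq0.
have f0: f != 0.
  by apply: contra_eq_neq ef => ->; rewrite linear0r eq_sym oner_neq0.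
have := dimv_sum_cap <[e]> <[f]>; rewrite !dim_vline e0 f0.
suff ->: (<[e]> :&: <[f]>)%VS = 0%VS by rewrite dimv0 addn0.
apply/eqP; rewrite -subv0; apply/subvP=> y; rewrite memv_cap memv0.
case/andP=> /vlineP[a ya] /vlineP[b yb].
have: form y f = 0 by rewrite yb linearZl_LR /= form0 mulr0.
by rewrite ya linearZl_LR /= ef mulr1 => ->; rewrite scale0r.
Qed.

(** Intersecting with the kernel of a functional costs at most one dimension. *)
Lemma orthogonal_dim e f : exists2 A : {vspace V}, (D - 2 <= \dim A)%N &
  forall x, x \in A -> form x e = 0 /\ form x f = 0.
Proof.
have lin u : linear (form ^~ u : V -> F^o).
  by move=> a y z; rewrite linearDl linearZl_LR.
have [phi phiE] := linear_hom (lin e); have [psi psiE] := linear_hom (lin f).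
exists (lker phi :&: lker psi)%VS => [|x]; last first.
  by rewrite memv_cap !memv_ker phiE psiE => /andP[/eqP-> /eqP->].
have le1 (X : {vspace F^o}) : (\dim X <= 1)%N.
  by have := dimvS (subvf X); rewrite dimvf /dim.
have := limg_ker_dim phi fullv; have := le1 (limg phi); rewrite capfv.
have := limg_ker_dim psi (lker phi); have := le1 (psi @: lker phi)%VS.
move: (\dim (psi @: lker phi)) (\dim (limg phi)) (\dim (lker phi)) => i j k.
move: (\dim _) D => a d; lia.
Qed.

Lemma minus_one_involution : (0 < D)%N ->
  exists (g : {perm fV}) (h : 'End(V)) A B,
  [/\ g \in GSp form, forall x : V, h x = g x, forall x, g (g x) = x,
      (D - 2 <= \dim A)%N /\ (forall x, x \in A -> h x = x) &
      \dim B = 2%N /\ (forall x, x \in B -> h x = - x)].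
Proof.
have [form0 _] := sform.
move=> /(hyperbolic_pair sform)[e [f ef]].
have fe: form f e = -1 by rewrite (symplecticC sform) ef.
(* The orthogonal projection onto the hyperbolic plane; [1 - 2 p] is an isometry negating this plane
   and fixing its orthogonal complement. *)
pose p x := form x f *: e - form x e *: f.
have p_lin a x y: p (a *: x + y) = a *: p x + p y.
  rewrite /p !linearDl !linearZl_LR /= !scalerDl scalerBr !scalerA opprD.
  by rewrite addrACA.
have [|h hE] := @linear_hom F V V (fun x => x - 2 *: p x).
  move=> a x y; rewrite p_lin; move: (p x) (p y) => u v.
  by rewrite scalerDr scalerBr !scalerA (mulrC a) opprD addrACA.
have hf x : form (h x) f = - form x f.
  rewrite hE /p !(linearBl, linearZl_LR) /= form0 ef; ring.
have he x : form (h x) e = - form x e.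
  rewrite hE /p !(linearBl, linearZl_LR) /= form0 fe; ring.
have hh x : h (h x) = x.
  rewrite [LHS]hE /p hf he hE /p !scaleNr -opprD scalerN opprK.
  by rewrite subrK.
have [A dimA orthA] := orthogonal_dim e f.
have [|g [gG gh gg]] := @GSp_involution h 1 (oner_neq0 _) hh.
  move=> x y; rewrite !hE /p !(linearBl, linearBr, linearZl_LR, linearZr_LR) /=.
  rewrite !form0 ef fe !(symplecticC sform _ x) !(symplecticC sform _ y) .
  by rewrite mul1r; ring.
exists g, h, A, (<[e]> + <[f]>)%VS; split=> //.
  split=> // x /orthA[xe xf]; rewrite hE /p xe xf !scale0r subrr.
  by rewrite scaler0 subr0.
split=> [|x]; first exact: hyperbolic_dim.
case/memv_addP=> _ /vlineP[a ->] [_ /vlineP[b ->] ->].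
rewrite hE /p !(linearDl, linearZl_LR) /= !form0 ef fe.
rewrite !mulr0 add0r addr0 mulr1 mulrN1 scaleNr opprK.
by rewrite scaler_nat mulr2n opprD addrA subrr add0r.
Qed.

Lemma anti_involution : D = 2%N ->
  exists (g : {perm fV}) (h : 'End(V)) A B,
  [/\ g \in GSp form, forall x : V, h x = g x, forall x, g (g x) = x,
      \dim A = 1%N /\ (forall x, x \in A -> h x = x) &
      \dim B = 1%N /\ (forall x, x \in B -> h x = - x)].
Proof.
have [form0 _] := sform.
move=> D2; have [|e [f ef]] := hyperbolic_pair sform; first by rewrite D2.
have fe: form f e = -1 by rewrite (symplecticC sform) ef.
(* This is [diag(1, -1)] in the basis [e], [f], a similitude with factor [-1]. *)
have [|h hE] := @linear_hom F V V (fun x => form x f *: e + form x e *: f).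
  move=> a x y; rewrite !linearDl !linearZl_LR /=.
  by rewrite !scalerDl scalerDr !scalerA addrACA.
have dec x : x = form x f *: e - form x e *: f.
  have: x \in (<[e]> + <[f]>)%VS.
    suff ->: (<[e]> + <[f]>)%VS = fullv by apply: memvf.
    by apply/eqP; rewrite eqEdim subvf D2 hyperbolic_dim.
  case/memv_addP=> _ /vlineP[a ->] [_ /vlineP[b ->] ->].
  rewrite !(linearDl, linearZl_LR) /= !form0 ef fe.
  by rewrite !mulr0 add0r addr0 mulr1 mulrN1 scaleNr opprK.
have hh x : h (h x) = x.
  rewrite [LHS]hE hE !(linearDl, linearZl_LR) /= !form0 ef fe.
  by rewrite !mulr0 add0r addr0 mulr1 mulrN1 scaleNr -dec.
have [||g [gG gh gg]] := @GSp_involution h (-1) _ hh.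
- by rewrite oppr_eq0 oner_neq0.
- move=> x y; rewrite {2}(dec x) !hE.
  rewrite !(linearDl, linearNl, linearDr, linearZl_LR, linearZr_LR) /=.
  by rewrite !form0 ef fe !(symplecticC sform _ y); ring.
have e0: e != 0.
  by apply: contra_eq_neq ef => ->; rewrite linear0l eq_sym oner_neq0.
have f0: f != 0.
  by apply: contra_eq_neq ef => ->; rewrite linear0r eq_sym oner_neq0.
exists g, h, <[e]>%VS, <[f]>%VS; split=> //.
  split=> [|_ /vlineP[a ->]]; first by rewrite dim_vline e0.
  by rewrite linearZ /= hE form0 ef scale0r addr0 scale1r.
split=> [|_ /vlineP[a ->]]; first by rewrite dim_vline f0.
by rewrite linearZ /= hE form0 fe scale0r add0r scaleN1r scalerN.
Qed.

End Witnesses.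

(** The factorisation [(q ^ 2 - 1) (q ^ (d - 2) - 1)], with negative terms moved across. It exposes
    the factor [q - 1] to be cancelled when passing from vectors to lines. *)
Lemma expn_bound_eq q d : (0 < q)%N -> (2 <= d)%N ->
  (q ^ d + 1 = q ^ (d - 2) + q ^ 2
                 + (q - 1) * ((q + 1) * (q ^ (d - 2) - 1)))%N.
Proof.
move=> q0 d2; have := expn_gt0 q (d - 2); rewrite q0 /= => Q0.
rewrite -{1}(subnK d2) expnD -mulnn.
case: q (q ^ (d - 2))%N q0 Q0 => [//|r] [//|Q] _ _.
rewrite !subn1 /=; lia.
Qed.

(** * The Malle invariants over a finite field of odd characteristic *)

Section MalleInvariants.

Variables (F : finFieldType) (V : vectType F) (form : {biscalar V}).
Hypotheses (sform : symplectic form) (two0 : (2 : F) != 0) (q3 : (2 < #|F|)%N).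
Local Notation fV := (finvect_type V).
Local Notation q := #|F|.
Local Notation D := (\dim {:V}).

(** Nontrivial elements of the quotient are exactly the cosets of nonscalar similitudes. *)
Lemma PGSp_bounds_malle b :
    (forall g, g \in GSp form -> g \notin scalars V ->
       b <= 2 * ind (actperm (PGSp_proj form) (coset (scalars V) g)))%N ->
    (exists g, [/\ g \in GSp form, g \notin scalars V &
       2 * ind (actperm (PGSp_proj form) (coset (scalars V) g)) <= b])%N ->
  malle_invariant (PGSp_proj form) = (b %/ 2)%N.
Proof.
move=> lb [g [gG gS ub]].
have nS := subsetP (normal_norm (scalars_normal form)).
apply: malle_invariant_half => [_ /morphimP[k kN kG ->] k1|].
  by apply: lb => //; apply: contra k1 => kS; apply/eqP/coset_id.
exists (coset (scalars V) g); split=> //; first exact: mem_quotient.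
by apply: contra gS => /eqP/coset_idr->; rewrite ?nS.
Qed.

(** Both [1] and [-1] occur as eigenvalues, and they differ since [2 != 0]. *)
Lemma involution_nonscalar (g : {perm fV}) (h : 'End(V)) (A B : {vspace V}) :
    (forall x : V, h x = g x) -> (0 < \dim A)%N -> (0 < \dim B)%N ->
    (forall x, x \in A -> h x = x) -> (forall x, x \in B -> h x = - x) ->
  g \notin scalars V.
Proof.
move=> hE A0 B0 hA hB; apply/negP=> /scalarsP[c _ gc].
have [x x0 xA] : exists2 x : V, x != 0 & x \in A.
  by exists (vpick A); rewrite ?memv_pick // vpick0 -dimv_eq0 -lt0n.
have [y y0 yB] : exists2 y : V, y != 0 & y \in B.
  by exists (vpick B); rewrite ?memv_pick // vpick0 -dimv_eq0 -lt0n.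
have c1: c = 1.
  have := hA x xA; rewrite hE gc -[RHS]scale1r => /eqP.
  by rewrite -subr_eq0 -scalerBl scaler_eq0 (negPf x0) orbF subr_eq0 => /eqP.
have := hB y yB; rewrite hE gc c1 scale1r => /eqP.
rewrite -addr_eq0 -mulr2n -scaler_nat scaler_eq0 (negPf y0) orbF.
exact/negP.
Qed.

Lemma malle_vec_ge4 : (4 <= D)%N ->
  malle_invariant (GSp_vec form) = ((q ^ D - q ^ (D - 2)) %/ 2)%N.
Proof.
move=> D4; apply: malle_invariant_half => [g gG g1|].
  have [h hE] := GSp_hom gG.
  by rewrite leq_subLR addnC; apply: vec_ind_lb.
have [|g [h [A [B [gG hE gg [dA hA] [dB hB]]]]]] := minus_one_involution sform.
  by lia.
exists g; split=> //.
  (* The identity is a scalar, so a nonscalar [g] is nontrivial. *)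
  apply: contraTneq (group1 (scalars V)) => <-.
  by apply: involution_nonscalar hE _ _ hA hB; lia.
have := vec_ind_involution gG hE gg hA.
have: (q ^ (D - 2) <= q ^ \dim A)%N by rewrite leq_pexp2l //; lia.
by lia.
Qed.

Lemma malle_vec_2 : D = 2%N ->
  malle_invariant (GSp_vec form) = ((q ^ 2 - q) %/ 2)%N.
Proof.
move=> D2; apply: malle_invariant_half => [g gG g1|].
  have [h hE] := GSp_hom gG.
  by have := vec_ind_lb1 gG hE g1; rewrite D2 expn1 leq_subLR addnC.
have [g [h [A [B [gG hE gg [dA hA] [dB hB]]]]]] := anti_involution sform D2.
exists g; split=> //.
  apply: contraTneq (group1 (scalars V)) => <-.
  by apply: involution_nonscalar hE _ _ hA hB; lia.
have := vec_ind_involution gG hE gg hA; rewrite dA D2 expn1.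
by lia.
Qed.

Lemma malle_proj_ge4 : (4 <= D)%N ->
  malle_invariant (PGSp_proj form) = ((q + 1) * (q ^ (D - 2) - 1) %/ 2)%N.
Proof.
move=> D4.
have eq_bound := expn_bound_eq (ltnW (ltnW q3)) (ltnW (ltnW D4)).
apply: PGSp_bounds_malle => [g gG gS|].
  have [h hE] := GSp_hom gG.
  have := line_ind_lb gG hE sform D4 q3 two0 gS; rewrite eq_bound.
  rewrite addnC -(addnA (2 * _)%N) leq_add2r (mulnCA 2) leq_pmul2l //; lia.
have [|g [h [A [B [gG hE gg [dA hA] [dB hB]]]]]] := minus_one_involution sform.
  by lia.
exists g; split=> //; first by apply: involution_nonscalar hE _ _ hA hB; lia.
have := line_ind_involution gG hE two0 gg hA hB; rewrite dB eq_bound.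
have: (q ^ (D - 2) <= q ^ \dim A)%N by rewrite leq_pexp2l //; lia.
move=> leA le; rewrite -(@leq_pmul2l (q - 1)) ?(mulnCA _ 2); lia.
Qed.

Lemma malle_proj_2 : D = 2%N ->
  malle_invariant (PGSp_proj form) = ((q - 1) %/ 2)%N.
Proof.
move=> D2.
(* One factor [q - 1] cancels against the vectors on a line; the other is twice the invariant. *)
have eq_bound: (q ^ 2 + 1 = 2 * q + (q - 1) * (q - 1))%N.
  rewrite -mulnn; move: q q3 => [//|r] _; rewrite !subn1 /=; lia.
apply: PGSp_bounds_malle => [g gG gS|].
  have [h hE] := GSp_hom gG.
  have := line_ind_lb1 gG hE D2 gS; rewrite eq_bound.
  rewrite addnC leq_add2r (mulnCA 2) leq_pmul2l //; lia.
have [g [h [A [B [gG hE gg [dA hA] [dB hB]]]]]] := anti_involution sform D2.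
exists g; split=> //; first by apply: involution_nonscalar hE _ _ hA hB; lia.
have := line_ind_involution gG hE two0 gg hA hB.
rewrite dA dB D2 eq_bound expn1.
move=> le; rewrite -(@leq_pmul2l (q - 1)) ?(mulnCA _ 2); lia.
Qed.

End MalleInvariants.

(** * Specialisation to the prime field with [ell] elements *)

Theorem proposition7p3 (n ell : nat) (V : vectType 'F_ell)
    (form : {biscalar V}) :
  (1 <= n)%N -> prime ell -> odd ell ->
  \dim {:V} = (2 * n)%N -> symplectic form ->
  ((2 <= n)%N ->
     malle_invariant (GSp_vec form)
       = (ell ^ (2 * n - 2) * (ell ^ 2 - 1) %/ 2)%N /\
     malle_invariant (PGSp_proj form)
       = ((ell + 1) * (ell ^ (2 * n - 2) - 1) %/ 2)%N) /\
  (n = 1%N ->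
     malle_invariant (GSp_vec form) = (ell * (ell - 1) %/ 2)%N /\
     malle_invariant (PGSp_proj form) = ((ell - 1) %/ 2)%N).
Proof.
move=> _ pr_ell odd_ell dimV sform.
have oF: #|'F_ell| = ell := card_Fp pr_ell.
have ell3 := odd_prime_gt2 odd_ell pr_ell.
have two0: (2 : 'F_ell) != 0.
  by rewrite -(dvdn_pcharf (pchar_Fp pr_ell)) gtnNdvd.
have q3: (2 < #|'F_ell|)%N by rewrite oF.
split=> [n2 | n1].
  have D4: (4 <= \dim {:V})%N by rewrite dimV; lia.
  rewrite malle_vec_ge4 // malle_proj_ge4 // oF dimV; split=> //.
  rewrite mulnBr muln1 -expnD subnK //; lia.
have D2: \dim {:V} = 2%N by rewrite dimV n1.
by rewrite malle_vec_2 // malle_proj_2 // oF mulnBr muln1 mulnn.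
Qed.
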